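(* Let $m\ge1$, let $\tau\in\mathbb B_\infty$, and let $C_m(\tau):=\{w\tau w^{-1}\mid w\in\mathbb B_{m+1,\infty}\}$ denote the relative conjugacy class of $\tau$. Then $$\tau\in\mathbb B_m\quad\Longleftrightarrow\quad C_m(\tau)=\{\tau\}\quad\Longleftrightarrow\quad C_m(\tau)\text{ is finite}.$$
   Context: $\mathbb B_\infty$ is the infinite braid group, generated by $\sigma_1,\sigma_2,\dots$ subject to $\sigma_i\sigma_j\sigma_i=\sigma_j\sigma_i\sigma_j$ if $|i-j|=1$ and $\sigma_i\sigma_j=\sigma_j\sigma_i$ if $|i-j|>1$; $\mathbb B_m=\langle\sigma_1,\dots,\sigma_{m-1}\rangle$, with $\mathbb B_1$ the trivial subgroup; $\mathbb B_{m+1,\infty}=\langle\sigma_k\mid k\ge m+1\rangle$. *)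

(* Defs.v *)
From HB Require Import structures.
From mathcomp Require Import all_boot.
From mathcomp Require Import boolp classical_sets functions cardinality.

Set Implicit Arguments.
Unset Strict Implicit.
Unset Printing Implicit Defensive.

Local Open Scope classical_set_scope.
Local Open Scope quotient_scope.
Local Open Scope group_scope.

(* Generators are indexed from 0: the letter (i, b) stands for sigma_{i+1},
   inverted when b is true. *)
Definition braid_word := seq (nat * bool).

Inductive braid_equiv : braid_word -> braid_word -> Prop :=
| braid_equiv_refl u : braid_equiv u u
| braid_equiv_sym u v : braid_equiv u v -> braid_equiv v u
| braid_equiv_trans u v w :
    braid_equiv u v -> braid_equiv v w -> braid_equiv u w
| braid_equiv_cat u u' v v' :
    braid_equiv u u' -> braid_equiv v v' -> braid_equiv (u ++ v) (u' ++ v')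
| braid_equiv_cancel i b : braid_equiv [:: (i, b); (i, ~~ b)] [::]
| braid_equiv_braid i j : (j == i.+1) || (i == j.+1) ->
    braid_equiv [:: (i, false); (j, false); (i, false)]
                [:: (j, false); (i, false); (j, false)]
| braid_equiv_comm i j : (i.+1 < j)%N || (j.+1 < i)%N ->
    braid_equiv [:: (i, false); (j, false)] [:: (j, false); (i, false)].

Definition braid_equivb (u v : braid_word) : bool := `[< braid_equiv u v >].

Lemma braid_equivb_refl : reflexive braid_equivb.
Proof. by move=> u; apply/asboolP; exact: braid_equiv_refl. Qed.

Lemma braid_equivb_sym : symmetric braid_equivb.
Proof. by move=> u v; apply/asboolP/asboolP; exact: braid_equiv_sym. Qed.

Lemma braid_equivb_trans : transitive braid_equivb.
Proof.
move=> v u w /asboolP uv /asboolP vw; apply/asboolP.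
exact: braid_equiv_trans uv vw.
Qed.

Canonical braid_equivb_rel :=
  EquivRel braid_equivb braid_equivb_refl braid_equivb_sym braid_equivb_trans.

Definition braid : Type := {eq_quot braid_equivb}.

HB.instance Definition _ := Choice.on braid.

Definition braid_of (u : braid_word) : braid := \pi_({eq_quot braid_equivb}) u.

Lemma braid_ofP (u v : braid_word) :
  braid_of u = braid_of v <-> braid_equiv u v.
Proof.
split=> [/eqmodP/asboolP //|uv].
by apply/eqmodP/asboolP.
Qed.

Lemma braid_ofK (x : braid) : braid_of (repr x) = x.
Proof. exact: reprK. Qed.

Lemma braid_repr (u : braid_word) : braid_equiv (repr (braid_of u)) u.
Proof. by apply/braid_ofP; rewrite braid_ofK. Qed.

Definition word_inv (u : braid_word) : braid_word :=
  rev [seq (x.1, ~~ x.2) | x <- u].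

Lemma word_inv_cat u v : word_inv (u ++ v) = word_inv v ++ word_inv u.
Proof. by rewrite /word_inv map_cat rev_cat. Qed.

Lemma word_invK : involutive word_inv.
Proof.
move=> u; rewrite /word_inv map_rev revK -map_comp -[RHS]map_id.
by apply: eq_map => -[i b] /=; rewrite negbK.
Qed.

Lemma word_mulVl u : braid_equiv (word_inv u ++ u) [::].
Proof.
elim: u => [|[i b] u IH]; first exact: braid_equiv_refl.
rewrite -cat1s word_inv_cat -catA [X in _ ++ X]catA.
apply: braid_equiv_trans IH.
apply: braid_equiv_cat (braid_equiv_refl _) _.
rewrite -[X in braid_equiv _ X]cat0s.
apply: braid_equiv_cat _ (braid_equiv_refl u).
by have := braid_equiv_cancel i (~~ b); rewrite negbK.
Qed.

Lemma word_mulVr u : braid_equiv (u ++ word_inv u) [::].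
Proof. by have := word_mulVl (word_inv u); rewrite word_invK. Qed.

Lemma word_inv_equiv u v :
  braid_equiv u v -> braid_equiv (word_inv u) (word_inv v).
Proof.
move=> uv; have refl := braid_equiv_refl.
apply: (@braid_equiv_trans _ (word_inv u ++ (v ++ word_inv v))).
  rewrite -[X in braid_equiv X _]cats0; apply: braid_equiv_cat (refl _) _.
  exact: braid_equiv_sym (word_mulVr v).
rewrite catA -[X in braid_equiv _ X]cat0s.
apply: braid_equiv_cat _ (refl _).
apply: braid_equiv_trans (word_mulVl u).
exact: braid_equiv_cat (refl _) (braid_equiv_sym uv).
Qed.

Definition braid_one : braid := braid_of [::].
Definition braid_mul (x y : braid) : braid := braid_of (repr x ++ repr y).
Definition braid_inv (x : braid) : braid := braid_of (word_inv (repr x)).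

Lemma braid_mul_of u v :
  braid_mul (braid_of u) (braid_of v) = braid_of (u ++ v).
Proof. by apply/braid_ofP/braid_equiv_cat; exact: braid_repr. Qed.

Lemma braid_inv_of u : braid_inv (braid_of u) = braid_of (word_inv u).
Proof. by apply/braid_ofP/word_inv_equiv; exact: braid_repr. Qed.

Lemma braid_mulA : associative braid_mul.
Proof.
move=> x y z; rewrite -(braid_ofK x) -(braid_ofK y) -(braid_ofK z).
move: (repr x) (repr y) (repr z) => u v w.
by rewrite (braid_mul_of v w) (braid_mul_of u v) 2!braid_mul_of catA.
Qed.

Lemma braid_mul1x : left_id braid_one braid_mul.
Proof. by move=> x; rewrite -(braid_ofK x) braid_mul_of. Qed.

Lemma braid_mulx1 : right_id braid_one braid_mul.
Proof. by move=> x; rewrite -(braid_ofK x) braid_mul_of cats0. Qed.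

Lemma braid_mulVx : left_inverse braid_one braid_inv braid_mul.
Proof.
move=> x; rewrite -(braid_ofK x) braid_inv_of braid_mul_of.
by apply/braid_ofP; exact: word_mulVl.
Qed.

Lemma braid_mulxV : right_inverse braid_one braid_inv braid_mul.
Proof.
move=> x; rewrite -(braid_ofK x) braid_inv_of braid_mul_of.
by apply/braid_ofP; exact: word_mulVr.
Qed.

HB.instance Definition _ := isGroup.Build braid
  braid_mulA braid_mul1x braid_mulx1 braid_mulVx braid_mulxV.

Lemma braid_of_cat u v : braid_of (u ++ v) = braid_of u * braid_of v.
Proof. by rewrite -braid_mul_of. Qed.

Lemma braid_of_inv u : braid_of (word_inv u) = (braid_of u)^-1.
Proof. by rewrite -braid_inv_of. Qed.

(* sigma i is the generator usually written sigma_{i+1}. *)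
Definition sigma (i : nat) : braid := braid_of [:: (i, false)].

Definition subgroup_gen (G : groupType) (A : set G) : set G :=
  smallest (fun H : set G => group_closed [in H]) A.

(* sigma_1, ..., sigma_{m-1} are sigma 0, ..., sigma (m - 2). *)
Definition braid_upto (m : nat) : set braid :=
  subgroup_gen [set sigma i | i in [set i | (i.+1 < m)%N]].

(* sigma_k, k >= p, in the usual numbering is sigma i with k = i.+1. *)
Definition braid_from (p : nat) : set braid :=
  subgroup_gen [set sigma i | i in [set i | (p <= i.+1)%N]].

Definition rel_conj_class (m : nat) (tau : braid) : set braid :=
  [set w * tau * w^-1 | w in braid_from m.+1].

(* Main.v *)
Require Import Defs.
From mathcomp Require Import all_boot zify.
From mathcomp Require Import boolp classical_sets functions cardinality.
Local Open Scope classical_set_scope.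

(** Braids on disjoint sets of strands commute, so the class of a braid of B_m
is a singleton. All the content is in the converse: a finite class forces tau
into B_m.

The key fact ([upto_double_coset]) is that, in terms of zero-based generators,
a braid x on the strands 0, ..., n such that sigma_n x sigma_n^-1 is again a
braid on these strands already lives on the strands 0, ..., n-1. Granting it,
let tau be a braid on the strands 0, ..., n, with n >= m, whose class is finite.
The conjugates of tau by 1, sigma_n, sigma_(n+1) sigma_n, ... all lie in the
class, so two of them coincide, and the later one lives on one strand fewer than
expected. The key fact then carries this defect back along the sequence, one
conjugation at a time, until tau itself is seen to live on 0, ..., n-1
([finite_class_descent]). Repeating this brings tau down to B_m.

The key fact is proved by letting braids act on colourings of the positions
0, 1, 2, ..., as in the Hurwitz action on sequences of group elements: when two
strands cross, the one passing under is conjugated by the colour of the other.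
One also allows strands that are transparent (their crossings affect nobody
else) but remember, as a group element, the product of the colours they have
passed under. Two observations are combined.

- The double coset hypothesis forces x to leave the content of position n
  unchanged, for every colouring ([act_double_coset]): position n+1 is out of
  reach of both x and sigma_n x sigma_n^-1, and sigma_n brings the content of
  position n+1 to position n.

- Colour by braids: make strand n transparent, with memory 1, and give each
  other strand k the pure braid [loop k] in which strand n travels once around
  strand k. Then the memory records precisely the path along which strand n has
  been pulled: a braid x on the strands 0, ..., n factors as g b d, where g is
  the final memory, b does not involve strand n, and d is a fixed braid bringing
  strand n to its final position ([reached_upto]). If x leaves position n
  unchanged then g = 1 and d = 1, so that x = b ([upto_fix_strand]). This
  replaces the usual appeal to the freeness of the subgroup generated by the
  loops: the colours are the loops themselves, so the factor g is read off
  directly in the braid group. *)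

Set Implicit Arguments.
Unset Strict Implicit.
Unset Printing Implicit Defensive.

Local Open Scope group_scope.

(** * Generated subgroups and the braid subgroups *)

Section GeneratedSubgroup.
Variables (G : groupType) (A : set G).

Lemma subgroup_gen_gen x : A x -> subgroup_gen A x.
Proof. by move=> Ax H [_]; apply. Qed.

Lemma subgroup_gen1 : subgroup_gen A 1.
Proof. by move=> H [[H1 _] _]; move: H1; rewrite inE. Qed.

Lemma subgroup_genM x y :
  subgroup_gen A x -> subgroup_gen A y -> subgroup_gen A (x * y).
Proof.
move=> Ax Ay H [gH AH].
have /mem_set xH := Ax H (conj gH AH); have /mem_set yH := Ay H (conj gH AH).
by apply: set_mem; apply: (group_closedM gH).
Qed.

Lemma subgroup_genV x : subgroup_gen A x -> subgroup_gen A x^-1.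
Proof.
move=> Ax H [gH AH]; have /mem_set xH := Ax H (conj gH AH).
by apply: set_mem; apply: (group_closedV gH).
Qed.

Lemma subgroup_gen_ind (P : G -> Prop) :
    (forall x, A x -> P x) -> P 1 ->
    (forall x y, P x -> P y -> P (x * y^-1)) ->
  forall x, subgroup_gen A x -> P x.
Proof.
move=> AP P1 PM x; apply; split=> //; split; first exact/mem_set.
by move=> y z /set_mem Py /set_mem Pz; apply/mem_set/PM.
Qed.

End GeneratedSubgroup.

Lemma subgroup_gen_mono (G : groupType) (A B : set G) :
  A `<=` B -> subgroup_gen A `<=` subgroup_gen B.
Proof. by move=> AB x Ax H [gH BH]; apply: Ax; split=> // y /AB /BH. Qed.

Lemma sigma_comm i j :
  (i.+1 < j)%N || (j.+1 < i)%N -> commute (sigma i) (sigma j).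
Proof.
move=> ij; rewrite /commute /sigma -!braid_of_cat.
exact/braid_ofP/braid_equiv_comm.
Qed.

Lemma sigma_braid i :
  sigma i * sigma i.+1 * sigma i = sigma i.+1 * sigma i * sigma i.+1.
Proof.
rewrite /sigma -!braid_of_cat.
by apply/braid_ofP/braid_equiv_braid; rewrite eqxx.
Qed.

Lemma sigma_upto m i : (i.+1 < m)%N -> braid_upto m (sigma i).
Proof. by move=> im; apply: subgroup_gen_gen; exists i. Qed.

Lemma braid_upto_mono m n : (m <= n)%N -> braid_upto m `<=` braid_upto n.
Proof.
move=> mn; apply: subgroup_gen_mono => _ [i /= im <-].
by exists i => //=; apply: leq_trans mn.
Qed.

Lemma braid_of_letter i b :
  braid_of [:: (i, b)] = if b then (sigma i)^-1 else sigma i.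
Proof. by case: b; rewrite // /sigma -braid_of_inv. Qed.

Lemma braid_upto_exhausts x : exists n, braid_upto n x.
Proof.
rewrite -(braid_ofK x); elim: (repr x) => [|[i b] u [n un]].
  by exists 0%N; apply: subgroup_gen1.
exists (maxn n i.+2); rewrite -cat1s braid_of_cat; apply: subgroup_genM.
  rewrite braid_of_letter; have si : braid_upto (maxn n i.+2) (sigma i).
    by apply: sigma_upto; rewrite leq_maxr.
  by case: b => //; apply: subgroup_genV.
by apply: braid_upto_mono un; rewrite leq_maxl.
Qed.

(** * The action of braids on coloured strands *)

Section Hurwitz.
Variable G : groupType.

(** The content of a position is either [inl x], an ordinary strand of colour x,
or [inr g], a transparent strand with memory g. [hue] is the colour that the
others see when this strand passes over them, and [push] is the effect of being
passed over. With these two maps G + G is an augmented rack, and the braid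
relation below only uses that [push] is an action and that [hue] is equivariant. *)
Definition hue (r : G + G) : G := if r is inl x then x else 1.
Definition push (r : G + G) (y : G) : G + G :=
  match r with inl x => inl (x ^ y) | inr g => inr (g * y) end.

Lemma push1 r : push r 1 = r.
Proof. by case: r => x /=; rewrite ?conjg1 ?mulg1. Qed.

Lemma pushM r x y : push r (x * y) = push (push r x) y.
Proof. by case: r => z /=; rewrite ?conjgM ?mulgA. Qed.

Lemma hue_push r y : hue (push r y) = hue r ^ y.
Proof. by case: r => x //=; rewrite conj1g. Qed.

Lemma push_conj x y z :
  push (inl (x ^ z)) (hue (inl (y ^ z))) = inl ((x ^ y) ^ z).
Proof. by rewrite /= -conjJg. Qed.

(** The strand at position i.+1 passes over the one at position i. In the
inverse crossing the strand that comes back from position i.+1 is the one that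
had been passed over, by the strand now at position i; hence the inverse colour. *)
Definition hurwitz (T : nat -> G + G) (l : nat * bool) (k : nat) : G + G :=
  let: (i, b) := l in
  if k == i then
    if b then push (T i.+1) (hue (T i))^-1 else T i.+1
  else if k == i.+1 then
    if b then T i else push (T i) (hue (T i.+1))
  else T k.

Definition hurwitz_word := foldl hurwitz.

Lemma hurwitz_cancel T i b : hurwitz (hurwitz T (i, b)) (i, ~~ b) = T.
Proof.
apply/funext => k; rewrite /hurwitz; have n1 : (i.+1 == i) = false by lia.
rewrite !eqxx n1; case: (k =P i) => [->|_]; [|case: (k =P i.+1) => [->|//]].
  by case: b => //=; rewrite -pushM mulgV push1.
by case: b => //=; rewrite -pushM mulVg push1.
Qed.

Lemma hurwitz_word_equiv u v :
  braid_equiv u v -> forall T, hurwitz_word T u = hurwitz_word T v.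
Proof.
elim=> {u v} [//|u v _ IH T|u v w _ IH1 _ IH2 T|u u' v v' _ IH1 _ IH2 T|
              i b T|i j ij T|i j ij T].
- by rewrite IH.
- by rewrite IH1.
- by rewrite /hurwitz_word !foldl_cat -!/(hurwitz_word _ _) IH1 IH2.
- exact: hurwitz_cancel.
- (* Up to symmetry j = i.+1: only the last of three positions needs an argument,
     the strand that has been passed over by both of the others. *)
  wlog -> : i j ij / j = i.+1.
    case/orP: (ij) => /eqP e W; first exact: W.
    by rewrite [RHS]W //= e eqxx.
  rewrite /hurwitz_word /=; apply/funext => k; rewrite /hurwitz.
  have n1 : (i.+1 == i) = false by lia.
  have n2 : (i.+2 == i) = false by lia.
  have n3 : (i.+2 == i.+1) = false by lia.
  have n4 : (i == i.+1) = false by lia.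
  have n5 : (i == i.+2) = false by lia.
  rewrite !eqxx ?(n1, n2, n3, n4, n5, eqSS).
  case: (k =P i) => [->|_]; first by rewrite !(n4, n5).
  case: (k =P i.+1) => [//|_].
  case: (k =P i.+2) => [_|//].
  by rewrite hue_push -!pushM -conjgC.
- rewrite /hurwitz_word /=; apply/funext => k; rewrite /hurwitz.
  have n1 : (i == j) = false by lia.
  have n2 : (i == j.+1) = false by lia.
  have n3 : (i.+1 == j) = false by lia.
  have n1' : (j == i) = false by lia.
  have n2' : (j == i.+1) = false by lia.
  have n3' : (j.+1 == i) = false by lia.
  rewrite ?eqSS ?(n1, n2, n3, n1', n2', n3').
  case: (k =P i) => [->|_]; first by rewrite n1 n2.
  by case: (k =P i.+1) => [->|//]; rewrite n3 eqSS n1.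
Qed.

(** A right action, so that a product of braids acts from left to right. *)
Definition act (T : nat -> G + G) (x : braid) := hurwitz_word T (repr x).

Lemma act_of T u : act T (braid_of u) = hurwitz_word T u.
Proof. exact/hurwitz_word_equiv/braid_repr. Qed.

Lemma act_sigma T i : act T (sigma i) = hurwitz T (i, false).
Proof. exact: act_of. Qed.

Lemma act_sigma_here T i : act T (sigma i) i = T i.+1.
Proof. by rewrite act_sigma /hurwitz eqxx. Qed.

Lemma act_sigma_next T i :
  act T (sigma i) i.+1 = push (T i) (hue (T i.+1)).
Proof. by rewrite act_sigma /hurwitz eqxx (gtn_eqF (ltnSn i)). Qed.

Lemma act_sigma_away T i k :
  k != i -> k != i.+1 -> act T (sigma i) k = T k.
Proof. by rewrite act_sigma /hurwitz => /negPf -> /negPf ->. Qed.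

Lemma act1 T : act T 1 = T.
Proof. exact: act_of. Qed.

Lemma actM T x y : act T (x * y) = act (act T x) y.
Proof.
rewrite -(braid_ofK x) -(braid_ofK y) -braid_of_cat !act_of.
exact: foldl_cat.
Qed.

Lemma actVK x : cancel (act^~ x^-1) (act^~ x).
Proof. by move=> T; rewrite -actM mulVg act1. Qed.

Lemma actKV x : cancel (act^~ x) (act^~ x^-1).
Proof. by move=> T; rewrite -actM mulgV act1. Qed.

Lemma act_upto_fix n x :
  braid_upto n x -> forall T k, (n <= k)%N -> act T x k = T k.
Proof.
pose fixes y := forall T k, (n <= k)%N -> act T y k = T k.
apply: (@subgroup_gen_ind _ _ fixes).
- move=> _ [i /= im <-] T k nk.
  by apply: act_sigma_away; lia.
- by move=> T k _; rewrite act1.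
- move=> y z IHy IHz T k nk.
  by rewrite actM -[LHS](IHz _ _ nk) actVK IHy.
Qed.

(** With y the conjugate of x by sigma_n, sigma_n x = y sigma_n. Apply both sides
to the colouring S that sigma_n turns into T: since sigma_n moves position n+1,
untouched by y, to position n, the right-hand side has at n what S has at n+1,
which is T n; the left-hand side has at n what x makes of T there. *)
Lemma act_double_coset n x :
    braid_upto n.+1 x -> braid_upto n.+1 (sigma n * x * (sigma n)^-1) ->
  forall T, act T x n = T n.
Proof.
move=> xn yn T; set y := _ * _ in yn.
pose S := act T (sigma n)^-1.
have TS : T = act S (sigma n) by rewrite actVK.
rewrite {1}TS -actM (_ : sigma n * x = y * sigma n); last by rewrite mulgVK.
by rewrite actM act_sigma_here (act_upto_fix yn) // TS act_sigma_here.
Qed.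

End Hurwitz.

(** * Loops of the last strand *)

Section BraidRelation.
Variables (G : groupType) (s t w : G).
Hypotheses (sts : s * t * s = t * s * t) (sw : s * w = w * s).

(** These identities hold for any two elements in a braid relation and any w
commuting with the first. They are applied to s = sigma_i, t = sigma_(i+1) and
the braid w bringing the last strand to position i+2; then a and b are the loops
of the last strand around the strands i and i+1. *)
Lemma braid_shift : w * t * s * t = s * (w * t * s).
Proof. by rewrite !mulgA sw -!mulgA; congr (w * _); rewrite !mulgA sts. Qed.

Let a := w * t * s * s * (w * t)^-1.
Let b := w * t * t * w^-1.

Lemma braid_loop_up : s * a = b * s.
Proof.
apply: (mulIg (w * t)); rewrite /a /b -!mulgA mulVg mulg1.
rewrite (mulgA s w) sw -!mulgA; congr (w * _).
rewrite (mulgA s w) sw -mulgA mulKg.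
by rewrite !mulgA sts -!mulgA; congr (t * _); rewrite !mulgA sts.
Qed.

(** The product a * b, a loop around both strands, is not affected by their
crossing: it commutes with s. Together with the previous identity this determines
the conjugate of b. *)
Lemma braid_loop_down : s * b = a ^ b * s.
Proof.
have ab : a * b = w * (t * s * s * t) * w^-1.
  by rewrite /a /b -(mulgA (w * t) t) (mulgA _ (w * t)) mulgVK !mulgA.
have swV : s * w^-1 = w^-1 * s by apply: commuteV.
have sab : s * (a * b) = a * b * s.
  rewrite ab !mulgA sw -!mulgA -swV; congr (w * _).
  rewrite !mulgA; congr (_ * w^-1); rewrite sts -!mulgA; congr (t * (s * _)).
  by rewrite !mulgA sts.
apply: (mulgI b); rewrite conjgE (mulgA b s b) -braid_loop_up -(mulgA s a b) sab.
by rewrite (mulgA b _ s) mulVKg.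
Qed.

End BraidRelation.

Section Combing.
Variable n : nat.

Fixpoint staircase (j d : nat) : braid :=
  if d is d'.+1 then staircase j.+1 d' * sigma j else 1.

(** The product sigma_(n-1) ... sigma_j, in which the last strand n passes over the
others to reach position j. For j >= n the product is empty, so that [loop k]
below is sigma_k^2 when k >= n; this harmless extension commutes with every
braid on the strands 0, ..., n-1, as the colours of the positions beyond n
should. *)
Definition descent j := staircase j (n - j).

Lemma descent_top : descent n = 1.
Proof. by rewrite /descent subnn. Qed.

Lemma descentS j : (j < n)%N -> descent j.+1 * sigma j = descent j.
Proof. by move=> jn; rewrite /descent (_ : n - j = (n - j.+1).+1)%N //; lia. Qed.

Lemma descent_above j : (n <= j)%N -> descent j = 1.
Proof. by rewrite /descent => /eqP ->. Qed.

Lemma descent_ind (P : nat -> Prop) :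
    (forall j, (n <= j)%N -> P j) ->
    (forall j, (j < n)%N -> P j.+1 -> P j) ->
  forall j, P j.
Proof.
move=> Ptop PS j; move e: (n - j)%N => d; elim: d j e => [|d IH] j e.
  by apply: Ptop; lia.
by apply: PS; [|apply: IH]; lia.
Qed.

Lemma descent_comm i j : (i.+1 < j)%N -> commute (sigma i) (descent j).
Proof.
elim/descent_ind: j => j jn => [|IH] ij.
  by rewrite descent_above //; apply: commute1.
rewrite -descentS //; apply: commuteM; first by apply: IH; lia.
by apply: sigma_comm; rewrite ij.
Qed.

Lemma descent_shift i j : (j <= i)%N -> (i.+1 < n)%N ->
  descent j * sigma i.+1 = sigma i * descent j.
Proof.
elim/descent_ind: j => j jn => [|IH] ji i1n; first by lia.
case: (eqVneq j i) => [->|ne]; last first.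
  rewrite -(descentS jn) -mulgA.
  have -> : sigma j * sigma i.+1 = sigma i.+1 * sigma j.
    by apply: sigma_comm; lia.
  by rewrite !mulgA IH //; lia.
have i1 := descentS i1n; have i0 : (i < n)%N by lia.
rewrite -(descentS i0) -i1; apply: braid_shift; first exact: sigma_braid.
by apply: descent_comm.
Qed.

(** For k < n, a standard generator A_(k,n) of the pure braid group: strand n
passes over the strands k, ..., n-1, then under strand k, and returns over the
others. In particular a transparent strand n meets no colour but that of k. *)
Definition loop k := descent k * sigma k * (descent k.+1)^-1.

Lemma loop_up i : (i.+1 < n)%N -> sigma i * loop i = loop i.+1 * sigma i.
Proof.
move=> i1n; have i0 : (i < n)%N by lia.
rewrite /loop -(descentS i0) -(descentS i1n).
by apply: braid_loop_up; [exact: sigma_braid|apply: descent_comm].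
Qed.

Lemma loop_down i :
  (i.+1 < n)%N -> sigma i * loop i.+1 = loop i ^ loop i.+1 * sigma i.
Proof.
move=> i1n; have i0 : (i < n)%N by lia.
rewrite /loop -(descentS i0) -(descentS i1n).
by apply: braid_loop_down; [exact: sigma_braid|apply: descent_comm].
Qed.

Lemma loop_comm i k : (i.+1 < n)%N -> k != i -> k != i.+1 ->
  commute (sigma i) (loop k).
Proof.
move=> i1n ki ki1; have [lt_ki|le_ik] := ltnP k i.
  (* The descent past k turns sigma_i into sigma_(i+1), far from sigma_k. *)
  have kn : (k < n)%N by lia.
  have e : sigma i = sigma i.+1 ^ (descent k.+1)^-1.
    by rewrite conjgE invgK mulgA descent_shift // mulgK.
  have -> : loop k = (sigma k * sigma k) ^ (descent k.+1)^-1.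
    by rewrite conjgE invgK /loop -(descentS kn) !mulgA.
  rewrite /commute e -!conjMg; congr (_ ^ _).
  by apply: commuteM; apply: sigma_comm; lia.
have c := @descent_comm i.
apply: commuteM; last by apply: commuteV; apply: c; lia.
by apply: commuteM; [apply: c|apply: sigma_comm]; lia.
Qed.

(** The colouring expected from the initial one, namely [strands n 1 1], after the
braid g * b * descent j with g a product of loops: the transparent strand sits at
position j, and the other strands, with the gap at j closed up, carry the loops
transported by b. A product of loops changes no colour, whence the absence of g
there. *)
Definition strands (j : nat) (b g : braid) (k : nat) : braid + braid :=
  if k == j then inr g else inl (loop (if (k < j)%N then k else k.-1) ^ b^-1).

Definition reached (x : braid) (T : nat -> braid + braid) : Prop :=
  exists j b g, [/\ (j <= n)%N, braid_upto n b,
    x = g * b * descent j & T = strands j b g].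

Lemma strands_at j b g : strands j b g j = inr g.
Proof. by rewrite /strands eqxx. Qed.

Lemma strands_before j b g k :
  (k < j)%N -> strands j b g k = inl (loop k ^ b^-1).
Proof. by move=> kj; rewrite /strands kj (ltn_eqF kj). Qed.

Lemma strands_after j b g k :
  (j <= k)%N -> strands j b g k.+1 = inl (loop k ^ b^-1).
Proof. by move=> jk; rewrite /strands gtn_eqF ?ltnS // ltnNge (leqW jk). Qed.

Lemma strands_eqP (T : nat -> braid + braid) j b g :
    T j = inr g ->
    (forall k, (k < j)%N -> T k = inl (loop k ^ b^-1)) ->
    (forall k, (j <= k)%N -> T k.+1 = inl (loop k ^ b^-1)) ->
  T = strands j b g.
Proof.
move=> Tj Tlt Tgt; apply/funext => k; case: (ltngtP k j) => [kj|jk|->].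
- by rewrite Tlt // strands_before.
- by case: k jk => // k jk; rewrite Tgt // strands_after.
- by rewrite Tj strands_at.
Qed.

Lemma strands_under i b g :
  act (strands i b g) (sigma i) = strands i.+1 b (g * loop i ^ b^-1).
Proof.
apply: strands_eqP => [|k ki|k ik].
- by rewrite act_sigma_next strands_at strands_after ?leqnn.
- case: (eqVneq k i) => [->|ne]; first by rewrite act_sigma_here strands_after.
  by rewrite act_sigma_away ?strands_before //; lia.
- by rewrite act_sigma_away ?strands_after //; lia.
Qed.

Lemma strands_over i b g :
  act (strands i.+1 b g) (sigma i) = strands i b g.
Proof.
apply: strands_eqP => [|k ki|k ik].
- by rewrite act_sigma_here strands_at.
- by rewrite act_sigma_away ?strands_before //; lia.
- case: (eqVneq k i) => [->|ne].
    by rewrite act_sigma_next strands_at strands_before // push1.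
  by rewrite act_sigma_away ?strands_after //; lia.
Qed.

(** Conjugation by sigma_i permutes the loops by the same rule as the one by which
a crossing changes the colours; this makes [strands] equivariant in b. *)
Lemma loop_conj_sigma i b k : (i.+1 < n)%N ->
  loop k ^ (b * sigma i)^-1 =
  (if k == i then loop i.+1 else if k == i.+1 then loop i ^ loop i.+1
   else loop k) ^ b^-1.
Proof.
move=> i1n; rewrite invgM conjgM; congr (_ ^ _).
rewrite conjgE invgK mulgA; apply: (mulIg (sigma i)); rewrite mulgVK.
case: (eqVneq k i) => [->|ki]; first exact: loop_up.
case: (eqVneq k i.+1) => [->|ki1]; first exact: loop_down.
exact: loop_comm.
Qed.

(** A crossing of two ordinary strands is absorbed in b. With the gap at j closed
up, the generators that act beyond j have their index lowered, whence the shift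
in [strands_right]. *)
Lemma strands_left i j b g : (i.+1 < j)%N -> (j <= n)%N ->
  act (strands j b g) (sigma i) = strands j (b * sigma i) g.
Proof.
move=> ij jn; have i1n : (i.+1 < n)%N by lia.
apply: strands_eqP => [|k kj|k jk].
- by rewrite act_sigma_away ?strands_at //; lia.
- rewrite loop_conj_sigma //; case: (eqVneq k i) => [->|ki].
    by rewrite act_sigma_here strands_before.
  case: (eqVneq k i.+1) => [->|ki1].
    by rewrite act_sigma_next strands_before ?(ltnW ij) // strands_before // push_conj.
  by rewrite act_sigma_away // strands_before.
- rewrite loop_conj_sigma // !gtn_eqF ?act_sigma_away ?strands_after //; lia.
Qed.

Lemma strands_right i j b g : (j <= i)%N -> (i.+1 < n)%N ->
  act (strands j b g) (sigma i.+1) = strands j (b * sigma i) g.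
Proof.
move=> ji i1n; apply: strands_eqP => [|k kj|k jk].
- by rewrite act_sigma_away ?strands_at //; lia.
- rewrite loop_conj_sigma // !ltn_eqF ?act_sigma_away ?strands_before //; lia.
- rewrite loop_conj_sigma //; case: (eqVneq k i) => [->|ki].
    by rewrite act_sigma_here strands_after // leqW.
  case: (eqVneq k i.+1) => [->|ki1].
    by rewrite act_sigma_next strands_after ?leqW // strands_after ?leqW // push_conj.
  by rewrite act_sigma_away ?strands_after ?eqSS.
Qed.

(** The braid counterparts of the four moves of [strands]: g, b and j change in the
same way. *)
Lemma combed_under i b g :
  g * b * descent i * sigma i = g * loop i ^ b^-1 * b * descent i.+1.
Proof.
have le : loop i * descent i.+1 = descent i * sigma i by exact: mulgVK.
by rewrite -(mulgA g (_ ^ _)) -conjgCV (mulgA g b) -(mulgA _ (loop i)) le mulgA.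
Qed.

Lemma combed_over i b g : (i < n)%N ->
  g * b * descent i.+1 * sigma i = g * b * descent i.
Proof. by move=> i_n; rewrite -(mulgA (g * b)) descentS. Qed.

Lemma combed_left i j b g : (i.+1 < j)%N ->
  g * b * descent j * sigma i = g * (b * sigma i) * descent j.
Proof.
by move=> ij; rewrite -(mulgA _ (descent j)) -(descent_comm ij) !mulgA.
Qed.

Lemma combed_right i j b g : (j <= i)%N -> (i.+1 < n)%N ->
  g * b * descent j * sigma i.+1 = g * (b * sigma i) * descent j.
Proof.
by move=> ji i1n; rewrite -(mulgA _ (descent j)) (descent_shift ji i1n) !mulgA.
Qed.

(** The factorisation evolves by the four moves above: when the last strand passes
under, the colour it meets is multiplied into g; when it passes over, only its
position changes; when it is not involved, the crossing is absorbed in b. *)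
Lemma reached_sigma i x T : (i < n)%N ->
  reached x T -> reached (x * sigma i) (act T (sigma i)).
Proof.
move=> i_n [j [b [g [jn bn -> ->]]]].
have [lt_ij|lt_ji|eij] := ltngtP i j.
- have [<-|ne_ij] := eqVneq i.+1 j.
    by exists i, b, g; split; rewrite ?combed_over ?strands_over //; lia.
  have ij : (i.+1 < j)%N by lia.
  exists j, (b * sigma i), g.
  split; rewrite ?combed_left ?strands_left //.
  by apply: subgroup_genM => //; apply: sigma_upto; lia.
- case: i i_n lt_ji => // i i_n ji.
  exists j, (b * sigma i), g.
  split; rewrite ?combed_right ?strands_right //.
  by apply: subgroup_genM => //; apply: sigma_upto; lia.
- rewrite -eij; exists i.+1, b, (g * loop i ^ b^-1).
  by split; rewrite ?combed_under ?strands_under.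
Qed.

(** Each of the four moves is onto, so it can be undone explicitly. *)
Lemma reached_sigmaV i x T : (i < n)%N ->
  reached x T -> reached (x * (sigma i)^-1) (act T (sigma i)^-1).
Proof.
move=> i_n [j [b [g [jn bn -> ->]]]].
have bV k : (k.+1 < n)%N -> braid_upto n (b * (sigma k)^-1).
  by move=> kn; apply: subgroup_genM => //; apply: subgroup_genV; apply: sigma_upto.
have [lt_ij|lt_ji|eij] := ltngtP i j.
- have [<-|ne_ij] := eqVneq i.+1 j.
    exists i, b, (g * (loop i ^ b^-1)^-1); split=> //; first exact: ltnW.
      rewrite -{1}(mulgVK (loop i ^ b^-1) g).
      by rewrite -combed_under // mulgK.
    rewrite -{1}(mulgVK (loop i ^ b^-1) g).
    by rewrite -strands_under actKV.
  have ij : (i.+1 < j)%N by lia.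
  exists j, (b * (sigma i)^-1), g; split=> //.
  + by apply: bV; lia.
  + by rewrite -{1}(mulgVK (sigma i) b) -combed_left // mulgK.
  + by rewrite -{1}(mulgVK (sigma i) b) -strands_left // actKV.
- case: i i_n lt_ji => // i i_n ji.
  exists j, (b * (sigma i)^-1), g; split=> //.
  + exact: bV.
  + by rewrite -{1}(mulgVK (sigma i) b) -combed_right // mulgK.
  + by rewrite -{1}(mulgVK (sigma i) b) -strands_right // actKV.
- rewrite -eij; exists i.+1, b, g; split=> //.
  + by rewrite -combed_over // mulgK.
  + by rewrite -strands_over actKV.
Qed.

Lemma reached_upto y x T :
  braid_upto n.+1 y -> reached x T -> reached (x * y) (act T y).
Proof.
(* The equivalence, unlike the implication, defines a subgroup. *)
pose stable z := forall x T, reached x T <-> reached (x * z) (act T z).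
suff stable_upto z : braid_upto n.+1 z -> stable z.
  by move=> yn; apply: (proj1 (stable_upto y yn x T)).
move: z; apply: subgroup_gen_ind => [_ [i /= i_n <-]||z1 z2 s1 s2] {}x {}T.
- split=> [|r]; first exact: reached_sigma.
  by rewrite -(mulgK (sigma i) x) -(actKV (sigma i) T); apply: reached_sigmaV.
- by rewrite mulg1 act1.
- rewrite mulgA actM (s1 x T).
  by rewrite (s2 (x * z1 * z2^-1)) mulgVK actVK.
Qed.

(** An unchanged position n means that the factorisation of x has j = n and g = 1,
and then x is its factor b. *)
Lemma upto_fix_strand x :
  braid_upto n.+1 x -> act (strands n 1 1) x n = inr 1 -> braid_upto n x.
Proof.
move=> xn; have : reached 1 (strands n 1 1).
  exists n, 1, 1; split=> //; first exact: subgroup_gen1.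
  by rewrite descent_top !mulg1.
move=> /(reached_upto xn)[j [b [g [jn bn]]]]; rewrite mul1g => -> ->.
rewrite /strands; case: eqP => // <- [->].
by rewrite descent_top mul1g mulg1.
Qed.

End Combing.

(** * Finite relative conjugacy classes *)

Lemma upto_double_coset n x :
    braid_upto n.+1 x -> braid_upto n.+1 (sigma n * x * (sigma n)^-1) ->
  braid_upto n x.
Proof.
move=> xn yn; apply: upto_fix_strand => //.
by rewrite (act_double_coset xn yn) strands_at.
Qed.

Fixpoint shift_conj (n : nat) (tau : braid) (k : nat) : braid :=
  if k is k'.+1
  then sigma (n + k') * shift_conj n tau k' * (sigma (n + k'))^-1 else tau.

Lemma shift_conj_upto n tau k :
  braid_upto n.+1 tau -> braid_upto (n + k).+1 (shift_conj n tau k).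
Proof.
move=> taun; elim: k => [|k IH] /=; first by rewrite addn0.
have s : braid_upto (n + k.+1).+1 (sigma (n + k)).
  by apply: sigma_upto; lia.
apply: subgroup_genM; last exact: subgroup_genV.
apply: subgroup_genM => //.
by apply: braid_upto_mono IH; lia.
Qed.

(** The key fact applied k times: if the k-th conjugate misses its last strand, so
does the one before it. *)
Lemma shift_conj_descend n tau k :
    braid_upto n.+1 tau -> braid_upto (n + k) (shift_conj n tau k) ->
  braid_upto n tau.
Proof.
move=> taun; elim: k => [|k IH]; first by rewrite addn0.
rewrite addnS => /= yk; apply: IH; apply: upto_double_coset yk.
exact: shift_conj_upto.
Qed.

Lemma shift_conj_class m n tau k :
  (m <= n)%N -> rel_conj_class m tau (shift_conj n tau k).
Proof.
move=> mn; elim: k => [|k [w wm /= e]] /=.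
  by exists 1; [exact: subgroup_gen1|rewrite mul1g invg1 mulg1].
exists (sigma (n + k) * w); last by rewrite -e invgM !mulgA.
apply: subgroup_genM => //; apply: subgroup_gen_gen.
by exists (n + k)%N => //=; lia.
Qed.

(** Pigeonhole on the sequence of conjugates: if the i-th equals the j-th with
i < j, then the j-th misses its last strand, as the i-th does not reach it. *)
Lemma finite_class_descent m n tau : (m <= n)%N ->
    finite_set (rel_conj_class m tau) -> braid_upto n.+1 tau ->
  braid_upto n tau.
Proof.
move=> mn fin taun.
have [i [j [ij e]]] : exists i j, (i < j)%N /\ shift_conj n tau i = shift_conj n tau j.
  apply: contrapT => ninj; apply: infinite_nat.
  have -> : [set: nat] = shift_conj n tau @^-1` rel_conj_class m tau.
    by apply/seteqP; split=> // k _; apply: shift_conj_class.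
  apply: finite_preimage fin => i j _ _ e; apply: contrapT => ne; apply: ninj.
  case: (ltngtP i j) => [ij|ji|//]; [by exists i, j|by exists j, i].
apply: (@shift_conj_descend n tau j) => //; rewrite -e.
have le_ij : ((n + i).+1 <= n + j)%N by rewrite ltn_add2l.
by apply: (braid_upto_mono le_ij); apply: shift_conj_upto.
Qed.

Lemma finite_class_upto m tau :
  finite_set (rel_conj_class m tau) -> braid_upto m tau.
Proof.
move=> fin; have [n taun] := braid_upto_exhausts tau.
have {taun} : braid_upto (m + n) tau.
  by apply: braid_upto_mono taun; rewrite leq_addl.
elim: n => [|n IH]; first by rewrite addn0.
rewrite addnS => taun; apply: IH.
exact: (finite_class_descent (leq_addr n m) fin taun).
Qed.

Lemma upto_commute m x w :
  braid_upto m x -> braid_from m.+1 w -> commute w x.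
Proof.
move=> xm wm; suff: commute x w by apply: commute_sym.
pose cx y := commute x y; move: w wm.
apply: (@subgroup_gen_ind _ _ cx) => [_ [j /= jm <-]||y z]; last 2 first.
- exact: commute1.
- by move=> xy xz; apply: commuteM => //; apply: commuteV.
apply: commute_sym; pose cj y := commute (sigma j) y; move: x xm {cx}.
apply: (@subgroup_gen_ind _ _ cj) => [_ [i /= im <-]||y z].
- by apply: sigma_comm; lia.
- exact: commute1.
- by move=> xy xz; apply: commuteM => //; apply: commuteV.
Qed.

Lemma upto_rel_conj_class m tau :
  braid_upto m tau -> rel_conj_class m tau = [set tau].
Proof.
move=> taum; apply/seteqP; split=> [_ [w wm <-]|_ ->] /=.
  by rewrite (upto_commute taum wm) mulgK.
by exists 1; [exact: subgroup_gen1|rewrite mul1g invg1 mulg1].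
Qed.

Local Close Scope group_scope.

Theorem proposition4p12 (m : nat) (tau : braid) (hm : (1 <= m)%N) :
  (braid_upto m tau <-> rel_conj_class m tau = [set tau]) /\
  (rel_conj_class m tau = [set tau] <-> finite_set (rel_conj_class m tau)).
Proof.
have singleton_finite :
    rel_conj_class m tau = [set tau] -> finite_set (rel_conj_class m tau).
  by move=> ->; apply: finite_set1.
split; split=> //.
- exact: upto_rel_conj_class.
- by move=> /singleton_finite /finite_class_upto.
- by move=> /finite_class_upto /upto_rel_conj_class.
Qed.
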